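(* Let $\Gamma\ge 1$ and $\gamma>0$. Let $\xi_i:\Omega^n\times\Omega^n\to\mathbb{R}$, $1\le i\le 3$, be measurable functions such that $y\mapsto \xi_i(x,y)$ is $\mu^n$-integrable for every $x\in\Omega^n$, and let $$\xi_i'(x)=\int_{\Omega^n}\xi_i(x,y)\,d\mu^n(y).$$ If $\xi_3\ge 0$ and for all $t\ge 0$ $$\mu^{2n}\bigl(\xi_1\ge \xi_2+(\xi_3 t)^{1/2}\bigr)\le \Gamma e^{-\gamma t},$$ then for all $t\ge 0$ $$\mu^{n}\bigl(\xi_1'\ge \xi_2'+(\xi_3' t)^{1/2}\bigr)\le \Gamma e^{1-\gamma t}.$$
   Context: $(\Omega,\mu)$ is a probability space, $n\ge 1$, $\mu^n$ is the product measure on $\Omega^n$, and $\mu^{2n}=\mu^n\otimes\mu^n$ is the product measure on $\Omega^n\times\Omega^n$. *)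

(* Defs.v *)
From HB Require Import structures.
From mathcomp Require Import all_boot all_order all_algebra.
From mathcomp Require Import all_classical all_reals all_analysis.

Set Implicit Arguments.
Unset Strict Implicit.
Unset Printing Implicit Defensive.
Import Order.TTheory GRing.Theory Num.Theory.
Import numFieldNormedType.Exports.

Local Open Scope classical_set_scope.
Local Open Scope ring_scope.
Local Open Scope ereal_scope.

Definition tuple_cons d (T : measurableType d) n (p : T * n.-tuple T) :
  n.+1.-tuple T := [tuple of p.1 :: p.2].

Lemma measurable_tuple_cons d (T : measurableType d) n :
  measurable_fun [set: T * n.-tuple T] (@tuple_cons d T n).
Proof. exact: measurable_cons. Qed.

HB.instance Definition _ d (T : measurableType d) n :=
  isMeasurableFun.Build _ _ _ _ (@tuple_cons d T n)
    (@measurable_tuple_cons d T n).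

(** The [n]-fold product of [mu] on [n.-tuple T], whose canonical
    sigma-algebra is generated by the coordinates.  The library only has binary
    products, so the product is iterated and transported along [tuple_cons];
    [power_probability_box] is its defining property. *)
Fixpoint power_probability d (T : measurableType d) (R : realType)
    (mu : probability T R) n : probability (n.-tuple T) R :=
  match n with
  | 0 => \d_ ([tuple] : 0.-tuple T)
  | m.+1 => distribution (mu \x power_probability mu m) (@tuple_cons d T m)
  end.

Lemma measurable_box d (T : measurableType d) n (A : 'I_n -> set T) :
  (forall i, measurable (A i)) ->
  measurable [set x : n.-tuple T | forall i, A i (tnth x i)].
Proof.
move=> mA.
rewrite (_ : [set x : n.-tuple T | _] =
  \big[setI/setT]_(i < n) ((@tnth n T ^~ i) @^-1` A i)); last first.
  rewrite -bigcap_seq; apply/seteqP; split=> x /= h i; first by move=> _; apply: h.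
  by apply: h; rewrite /= mem_index_enum.
apply: bigsetI_measurable => i _; rewrite -[X in measurable X]setTI.
exact: measurable_tnth.
Qed.

Lemma power_probability_box d (T : measurableType d) (R : realType)
    (mu : probability T R) n (A : 'I_n -> set T) :
  (forall i, measurable (A i)) ->
  power_probability mu n [set x | forall i, A i (tnth x i)] =
  \prod_(i < n) mu (A i).
Proof.
elim: n A => [|n IHn] A mA /=.
  rewrite big_ord0 diracE mem_set//; by case.
pose B := [set y : n.-tuple T | forall i, A (lift ord0 i) (tnth y i)].
have mB : measurable B := measurable_box (fun i => mA (lift ord0 i)).
rewrite big_ord_recl -(IHn (fun i => A (lift ord0 i)))//.
rewrite -(product_measure1E _ _ (mA ord0) mB) /distribution /pushforward.
congr (_ _); apply/seteqP; split=> -[x y] /=.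
  move=> h; split=> [|i]; first exact: (h ord0).
  by have := h (lift ord0 i); rewrite /= tnthS.
move=> [hx hy] i; case: (unliftP ord0 i) => [j ->|->]; last exact: hx.
by rewrite tnthS; exact: hy.
Qed.

Definition partial_mean d1 d2 (X : measurableType d1) (Y : measurableType d2)
    (R : realType) (nu : {measure set Y -> \bar R}) (f : X * Y -> R) (x : X) : R :=
  (\int[nu]_y f (x, y))%R.

(* Main.v *)
Require Import Defs.
From HB Require Import structures.
From mathcomp Require Import all_boot all_order all_algebra.
From mathcomp Require Import all_classical all_reals all_analysis.
From mathcomp Require Import measurable_realfun ring lra.

Set Implicit Arguments.
Unset Strict Implicit.
Unset Printing Implicit Defensive.
Import Order.TTheory GRing.Theory Num.Theory.
Import numFieldNormedType.Exports.

Local Open Scope classical_set_scope.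
Local Open Scope ring_scope.

(** Write [a = xi1 - xi2] and [b = xi3].  The event at level [u] is
    [sqrt (b * u) <= a], and the proof works with the Lebesgue measure [G] of
    the set of levels [u >= s] for which it holds, where [s = t - 1 / gamma].
    (When [gamma * t <= 1] the claimed bound is at least [1].)

    By Tonelli, the integral of [G] over both variables is the integral over
    [u >= s] of the probability of the event at level [u], hence at most
    [(Gamma / gamma) * exp (- gamma * s)] ([integral_length_levels_le]).

    In the other direction, [G] dominates every affine function
    [2 q a - q ^ 2 b - s] with [q >= 0] ([length_levels_ge]), because
    [(a - q b) ^ 2 >= 0].  These functions commute with the integration in the
    second variable, so Jensen's inequality amounts to the choice of the
    optimal slope [q = a' / b'], where [a'] and [b'] are the partial means: at
    every [x] with [sqrt (b' * t) <= a'] the inner integral of [G] is at least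
    [a' ^ 2 / b' - s >= t - s = 1 / gamma] ([le_integral_length_levels]).
    Markov's inequality then bounds the probability of these [x] by
    [Gamma * exp (- gamma * s) = Gamma * exp (1 - gamma * t)].

    No slope is available when [b' = 0].  Then [b = 0] almost everywhere, and
    [G] is infinite wherever [b = 0] and [a >= 0]; this happens with positive
    probability, for otherwise [a] would be negative almost everywhere and
    [a'] would be negative.  Measuring the levels, rather than using
    [a ^ 2 / b], is what makes [G] infinite at [a = b = 0], where the event
    holds at all levels. *)

(** * The measure of the set of levels *)

Definition quadratic_levels (R : realType) (s a b : R) : set R :=
  [set u | s <= u /\ Num.sqrt (b * u) <= a].

Section levels.
Context (R : realType).
Local Notation leb := (@lebesgue_measure R).

Lemma measurable_sqrt_le_graph d (Z : measurableType d) (a b : Z -> R) (s : R) :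
  measurable_fun setT a -> measurable_fun setT b ->
  measurable [set w : Z * R | s <= w.2 /\ Num.sqrt (b w.1 * w.2) <= a w.1].
Proof.
move=> ma mb.
rewrite (_ : [set w | _] = [set w : Z * R | s <= w.2] `&`
    [set w : Z * R | Num.sqrt (b w.1 * w.2) <= a w.1]); last first.
  by apply/seteqP; split.
apply: measurableI; rewrite -[X in measurable X]setTI.
  by apply: measurable_fun_le.
apply: measurable_fun_le => //; last exact: measurableT_comp.
apply: measurableT_comp.
  by apply: continuous_measurable_fun; exact: sqrt_continuous.
by apply: measurable_funM => //; exact: measurableT_comp.
Qed.

Lemma xsection_sqrt_le_graph (Z : Type) (a b : Z -> R) (s : R) (z : Z) :
  xsection [set w : Z * R | s <= w.2 /\ Num.sqrt (b w.1 * w.2) <= a w.1] z =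
  quadratic_levels s (a z) (b z).
Proof. by apply/seteqP; split=> u; rewrite /xsection/= inE. Qed.

Lemma measurable_quadratic_levels (s a b : R) :
  measurable (quadratic_levels s a b).
Proof.
rewrite -(xsection_sqrt_le_graph (cst a) (cst b) s tt).
by apply: measurable_xsection; apply: measurable_sqrt_le_graph.
Qed.

Lemma measurable_fun_length_levels d (Z : measurableType d) (a b : Z -> R)
    (s : R) : measurable_fun setT a -> measurable_fun setT b ->
  measurable_fun setT (fun z => leb (quadratic_levels s (a z) (b z))).
Proof.
move=> ma mb.
rewrite (_ : (fun z => _) = leb \o xsection
    [set w : Z * R | s <= w.2 /\ Num.sqrt (b w.1 * w.2) <= a w.1]); last first.
  by apply/funext => z /=; rewrite xsection_sqrt_le_graph.
by apply: measurable_fun_xsection; exact: measurable_sqrt_le_graph.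
Qed.

(** The value [2 q a - q ^ 2 b] is at most [a ^ 2 / b], so when it exceeds [s]
    all the levels between the two belong to the set.  Unlike [a ^ 2 / b], it
    is affine in [(a, b)] and makes sense for [b = 0]. *)
Lemma length_levels_ge (s a b q : R) : 0 <= s -> 0 <= b -> 0 <= q ->
  ((2 * q * a - q ^+ 2 * b - s)%:E <= leb (quadratic_levels s a b))%E.
Proof.
move=> s0 b0 q0; set v := 2 * q * a - q ^+ 2 * b.
have [vs|sv] := leP v s.
  by apply: le_trans (measure_ge0 _ _); rewrite lee_fin subr_le0.
have -> : ((v - s)%:E = leb `[s, v]%classic)%E.
  by rewrite lebesgue_measure_itv/= lte_fin sv EFinD.
apply: le_measure; rewrite ?inE; first exact: measurable_itv.
  exact: measurable_quadratic_levels.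
move=> u /=; rewrite in_itv/= => /andP[su uv]; split=> //.
have u0 : 0 <= u by exact: le_trans su.
have a0 : 0 <= a.
  rewrite leNgt; apply/negP => a0; move: sv; rewrite ltNge => /negP; apply.
  by rewrite /v; nra.
rewrite -[leRHS]ger0_norm// -sqrtr_sqr ler_wsqrtr//.
apply: (@le_trans _ _ (b * v)); first exact: ler_wpM2l.
rewrite -subr_ge0 (_ : _ - _ = (a - q * b) ^+ 2) ?sqr_ge0//.
by rewrite /v; lra.
Qed.

Lemma length_levels_pinfty (s a : R) :
  0 <= a -> leb (quadratic_levels s a 0) = +oo%E.
Proof.
move=> a0; rewrite (_ : quadratic_levels s a 0 = `[s, +oo[%classic).
  by rewrite lebesgue_measure_itv/= ltry.
apply/seteqP; split=> u; rewrite /quadratic_levels/= in_itv/= andbT.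
  by case.
by move=> su; split=> //; rewrite mul0r sqrtr0.
Qed.

Lemma Rintegral_ae_lt0 d (Y : measurableType d) (Q : probability Y R)
    (a : Y -> R) :
  Q.-integrable setT (EFin \o a) -> {ae Q, forall y, a y < 0} ->
  \int[Q]_y a y < 0.
Proof.
move=> ia a_lt0; rewrite ltNge; apply/negP => A0.
have ma : measurable_fun setT a.
  by apply/measurable_EFinP; exact: measurable_int ia.
have fa : (\int[Q]_y (a y)%:E)%E \is a fin_num by exact: integrable_fin_num.
have ia0 : (\int[Q]_y `|(a y)%:E| = 0)%E.
  apply/eqP; rewrite eq_le integral_ge0 ?andbT//.
  rewrite (ae_eq_integral (fun y => - (a y)%:E)%E)//.
  - rewrite integralN; last first.
      by rewrite fin_num_adde_defl// fin_numN integrable_neg_fin_num.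
    by rewrite oppe_le0 -(fineK fa) lee_fin; exact: A0.
  - by apply: measurableT_comp => //; exact/measurable_EFinP.
  - by apply: measurableT_comp => //; exact/measurable_EFinP.
  - by apply: filterS a_lt0 => y ay0 _; rewrite /= ltr0_norm.
have a_ae0 : ae_eq Q setT (EFin \o a) (cst 0%E).
  by apply/(ae_eq_integral_abs _ measurableT) => //; exact: measurable_int ia.
have [y []] : exists y, a y < 0 /\ a y = 0.
  apply: (@filter_ex _ (almost_everywhere Q)).
    apply: ae_properfilter_algebraOfSetsType.
    by rewrite [X in (_ < X)%E]probability_setT ?lte01.
  by apply: filterS2 a_lt0 a_ae0 => y ? /(_ I)[].
by move=> + ay0; rewrite ay0 ltxx.
Qed.

(** This plays the role of Jensen's inequality: the integral is bounded below
    through the affine minorants of the integrand, except when the mean of [b]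
    vanishes, in which case the integral is infinite. *)
Lemma le_integral_length_levels d (Y : measurableType d) (Q : probability Y R)
    (a b : Y -> R) (s t : R) :
  Q.-integrable setT (EFin \o a) -> Q.-integrable setT (EFin \o b) ->
  (forall y, 0 <= b y) -> 0 <= s <= t ->
  Num.sqrt ((\int[Q]_y b y) * t) <= \int[Q]_y a y ->
  ((t - s)%:E <= \int[Q]_y leb (quadratic_levels s (a y) (b y)))%E.
Proof.
move=> ia ib b0 /andP[s0 st] hAB.
have ma : measurable_fun setT a.
  by apply/measurable_EFinP; exact: measurable_int ia.
have mb : measurable_fun setT b.
  by apply/measurable_EFinP; exact: measurable_int ib.
set G := fun y => leb (quadratic_levels s (a y) (b y)).
have mG : measurable_fun setT G by exact: measurable_fun_length_levels.
have G0 y : (0 <= G y)%E by exact: measure_ge0.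
have [->|Gfin] := eqVneq (\int[Q]_y G y)%E +oo%E; first exact: leey.
have iG : Q.-integrable setT G.
  apply/integrableP; split=> //; under eq_integral do rewrite gee0_abs//.
  by rewrite ltey.
have A0 : 0 <= \int[Q]_y a y by apply: le_trans hAB; exact: sqrtr_ge0.
have : 0 <= \int[Q]_y b y by exact: Rintegral_ge0.
rewrite le_eqVlt => /predU1P[B0|B0].
  have ib0 : (\int[Q]_y (b y)%:E = 0)%E.
    by rewrite -[LHS]fineK ?integrable_fin_num// -/(Rintegral _ _ _) -B0.
  have b_ae0 : ae_eq Q setT (EFin \o b) (cst 0%E).
    apply/(ae_eq_integral_abs _ measurableT); first exact: measurable_int ib.
    by under eq_integral do rewrite gee0_abs ?lee_fin//.
  have a_lt0 : {ae Q, forall y, a y < 0}.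
    apply: filterS2 b_ae0 (integrable_ae measurableT iG) => y /=.
    move=> /(_ I)[by0] /(_ I).
    rewrite /G by0 ltNge; apply: contraTN => ay0.
    by rewrite length_levels_pinfty.
  by have := Rintegral_ae_lt0 ia a_lt0; rewrite ltNge A0.
(* The slope at which [2 q a' - q ^ 2 b'] attains its maximum [a' ^ 2 / b']. *)
pose q := (\int[Q]_y a y) / \int[Q]_y b y.
have q0 : 0 <= q by rewrite divr_ge0// ltW.
have iqa : Q.-integrable setT (EFin \o (fun y => 2 * q * a y)).
  exact: (integrableZl measurableT _ ia).
have iqb : Q.-integrable setT (EFin \o (fun y => q ^+ 2 * b y)).
  exact: (integrableZl measurableT _ ib).
have iqab : Q.-integrable setT
    (EFin \o (fun y => 2 * q * a y - q ^+ 2 * b y)).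
  exact: (integrableB measurableT iqa iqb).
have is_ : Q.-integrable setT (EFin \o (fun _ : Y => s)).
  exact: finite_measure_integrable_cst.
have iv : Q.-integrable setT
    (EFin \o (fun y => 2 * q * a y - q ^+ 2 * b y - s)).
  exact: (integrableB measurableT iqab is_).
apply: (@le_trans _ _ (\int[Q]_y (2 * q * a y - q ^+ 2 * b y - s)%:E)%E).
  rewrite -[leRHS]fineK; last exact: integrable_fin_num.
  rewrite -/(Rintegral _ _ _) RintegralB// RintegralB// !RintegralZl//.
  rewrite Rintegral_cst//.
  have -> : fine (Q [set: Y]) = 1 by exact: (congr1 fine (probability_setT Q)).
  rewrite mulr1 lee_fin lerB//.
  have t0 : 0 <= t by exact: le_trans st.
  rewrite (_ : 2 * q * _ - _ = (\int[Q]_y a y) ^+ 2 / \int[Q]_y b y);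
    last first.
    by rewrite /q; field; exact: lt0r_neq0.
  rewrite ler_pdivlMr// mulrC.
  rewrite -[leLHS]sqr_sqrtr; last by rewrite mulr_ge0// ltW.
  by rewrite lerXn2r// nnegrE sqrtr_ge0.
refine (le_integral measurableT iv iG _).
by move=> y _; exact: length_levels_ge.
Qed.

End levels.

(** * Exponential tails and partial means *)

Lemma integral_expR_tail (R : realType) (c s : R) : 0 < c ->
  (\int[@lebesgue_measure R]_(u in `[s, +oo[) (expR (- (c * u)))%:E =
   (expR (- (c * s)) / c)%:E)%E.
Proof.
move=> c0.
have dF (x : R) : is_derive x (1 : R)
    (fun u : R => - (expR (- (c * u)) / c)) (expR (- (c * x))).
  by apply: is_derive_eq; rewrite /GRing.scale/=; field; exact: lt0r_neq0.
have cF : continuous (fun u : R => - (expR (- (c * u)) / c)).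
  move=> x; apply: differentiable_continuous.
  exact/derivable1_diffP/ex_derive.
rewrite (@ge0_continuous_FTC2y _ _ (fun u : R => - (expR (- (c * u)) / c)) _ 0).
- by rewrite -EFinN -EFinD add0r opprK.
- by move=> x _; exact: expR_ge0.
- apply: continuous_subspaceT => x.
  apply: continuous_comp; last exact: continuous_expR.
  by apply: continuousN; exact: mulrl_continuous.
- suff : - (expR (- (c * u)) / c) @[u --> +oo] --> - (0 / c).
    by rewrite mul0r oppr0.
  apply: cvgN; apply: cvgMl.
  apply: (@cvg_comp _ _ _ _ (fun z => expR (- z)) _ (pinfty_nbhs R)).
    exact: gt0_cvgMry.
  exact: cvgr_expR.
- by move=> x _; apply: ex_derive.
- exact/cvg_at_right_filter/cF.
- by move=> x _; rewrite derive1E derive_val.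
Qed.

Lemma measurable_partial_mean d1 d2 (X : measurableType d1)
    (Y : measurableType d2) (R : realType) (Q : probability Y R)
    (f : X * Y -> R) :
  measurable_fun setT f -> measurable_fun setT (partial_mean Q f).
Proof.
move=> mf; have mfE : measurable_fun setT (EFin \o f) by exact/measurable_EFinP.
apply: measurableT_comp => //.
rewrite (_ : (fun x => _) =
    fubini_F Q (EFin \o f)^\+ \- fubini_F Q (EFin \o f)^\-)%E.
  apply: emeasurable_funB.
    by apply: measurable_fun_fubini_tonelli_F => //; exact: measurable_funepos.
  by apply: measurable_fun_fubini_tonelli_F => //; exact: measurable_funeneg.
by apply/funext => x; rewrite [LHS]integralE; congr (_ - _)%E;
  apply: eq_integral => y _; rewrite ?funeposE ?funenegE.
Qed.

(** Tonelli exchanges the integral over [Z] with the length, leaving the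
    integral over the levels [u >= s] of the assumed tail bound. *)
Lemma integral_length_levels_le (R : realType) d (Z : measurableType d)
    (P : probability Z R) (C c s : R) (a b : Z -> R) :
  0 <= C -> 0 < c -> 0 <= s ->
  measurable_fun setT a -> measurable_fun setT b ->
  (forall u : R, 0 <= u -> (P [set z | (Num.sqrt (b z * u) <= a z)%R]
     <= (C * expR (- (c * u)))%:E)%E) ->
  (\int[P]_z lebesgue_measure (quadratic_levels s (a z) (b z))
     <= (C * (expR (- (c * s)) / c))%:E)%E.
Proof.
move=> C0 c0 s0 ma mb tail.
pose G z := lebesgue_measure (quadratic_levels s (a z) (b z)).
rewrite -[leLHS]/(\int[P]_z G z)%E.
pose A := [set w : Z * R | s <= w.2 /\ Num.sqrt (b w.1 * w.2) <= a w.1].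
have mA : measurable A by exact: measurable_sqrt_le_graph.
have := @indic_fubini_tonelli _ _ _ _ _ P (@lebesgue_measure R) _ mA.
rewrite indic_fubini_tonelli_FE// indic_fubini_tonelli_GE//.
have -> : lebesgue_measure \o xsection A = G.
  by apply/funext => z /=; rewrite xsection_sqrt_le_graph.
move=> ->.
have mexp : measurable_fun setT (fun u : R => (expR (- (c * u)))%:E).
  apply/measurable_EFinP; apply: continuous_measurable_fun => u.
  apply: continuous_comp; last exact: continuous_expR.
  by apply: continuousN; exact: mulrl_continuous.
rewrite EFinM -integral_expR_tail// -ge0_integralZl//=; last first.
  exact: measurable_funTS.
rewrite [leRHS]integral_mkcond; apply: ge0_le_integral => //.
- exact: (measurable_fun_ysection P mA).
- apply/(measurable_restrictT _ (measurable_itv _)).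
  by apply: measurable_funTS; apply: measurable_funeM.
move=> u _ /=; rewrite patchE; case: ifPn => [|].
  rewrite inE/= in_itv/= andbT => su.
  apply: le_trans (tail u (le_trans s0 su)).
  rewrite le_eqVlt; apply/orP; left; apply/eqP; congr (_ _).
  by apply/seteqP; split=> z; rewrite /ysection/= inE/=; [case|].
rewrite notin_setE/= in_itv/= andbT => su.
rewrite (_ : ysection _ _ = set0) ?measure0//.
by apply/seteqP; split=> z //; rewrite /ysection/= inE/= => -[].
Qed.

(** The factor [expR 1] is the price of Markov's inequality: the tail bound is
    used at the levels above [t - 1 / c] instead of at [t]. *)
Lemma partial_mean_exp_tail (R : realType) d1 d2 (X : measurableType d1)
    (Y : measurableType d2) (P : probability X R) (Q : probability Y R)
    (C c : R) (a b : X * Y -> R) :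
  1 <= C -> 0 < c ->
  measurable_fun setT a -> measurable_fun setT b ->
  (forall x, Q.-integrable setT (fun y => (a (x, y))%:E)) ->
  (forall x, Q.-integrable setT (fun y => (b (x, y))%:E)) ->
  (forall z, 0 <= b z) ->
  (forall t : R, 0 <= t -> ((P \x Q)%E [set z | (Num.sqrt (b z * t) <= a z)%R]
     <= (C * expR (- (c * t)))%:E)%E) ->
  forall t : R, 0 <= t ->
  (P [set x | (Num.sqrt (partial_mean Q b x * t) <= partial_mean Q a x)%R]
     <= (C * expR (1 - c * t))%:E)%E.
Proof.
move=> C1 c0 ma mb ia ib b0 tail t t0.
have C0 : 0 < C by exact: lt_le_trans ltr01 C1.
set E := [set x | _].
have mE : measurable E.
  rewrite -[X in measurable X]setTI; apply: measurable_fun_le => //; last first.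
    exact: measurable_partial_mean.
  apply: measurableT_comp.
    by apply: continuous_measurable_fun; exact: sqrt_continuous.
  by apply: measurable_funM => //; exact: measurable_partial_mean.
have [ct1|ct1] := leP (c * t) 1.
  apply: (le_trans (probability_le1 P mE)); rewrite lee_fin.
  by apply: mulr_ege1 => //; rewrite -[leLHS]expR0 ler_expR subr_ge0.
(* With [s = t - h], Markov's inequality gives a bound proportional to
   [expR (c * h) / h], which is smallest at [h = 1 / c]. *)
pose s := t - c^-1.
have s0 : 0 <= s by rewrite subr_ge0 -div1r ler_pdivrMr// mulrC ltW.
have st : s <= t by rewrite gerBl invr_ge0 ltW.
pose G z := lebesgue_measure (quadratic_levels s (a z) (b z)).
have mG : measurable_fun setT G by exact: measurable_fun_length_levels.
have G0 z : (0 <= G z)%E by exact: measure_ge0.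
(* Markov's inequality for the inner integral, at the level [1 / c = t - s]. *)
have lowE : (c^-1%:E * P E <= \int[P]_x \int[Q]_y G (x, y))%E.
  rewrite -integral_cst//.
  have mH : measurable_fun setT (fubini_F Q G).
    exact: measurable_fun_fubini_tonelli_F.
  apply: (@le_trans _ _ (\int[P]_(x in E) fubini_F Q G x)%E).
    apply: ge0_le_integral => //.
    - by move=> x _; rewrite lee_fin invr_ge0 ltW.
    - exact: measurable_funTS mH.
    move=> x Ex; rewrite (_ : c^-1 = t - s); last by rewrite /s; lra.
    apply: (le_integral_length_levels (ia x) (ib x)) => //.
    by rewrite s0.
  by apply: ge0_subset_integral => // x _; apply: integral_ge0.
have upG : (\int[(P \x Q)%E]_z G z <= (C * (expR (- (c * s)) / c))%:E)%E.
  exact: (@integral_length_levels_le _ _ _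
    ((P \x Q)%E : probability (X * Y)%type R) _ _ _ _ _ (ltW C0)).
rewrite -fubini_tonelli1// in lowE.
have := le_trans lowE upG.
rewrite -lee_pdivlMl ?invr_gt0// invrK => /le_trans; apply.
rewrite -EFinM lee_fin mulrCA ler_wpM2l ?(ltW C0)//.
rewrite mulrCA divff ?lt0r_neq0// mulr1 ler_expR /s.
by rewrite mulrBr divff ?lt0r_neq0// opprB.
Qed.

Theorem corollary1 (R : realType) (d : measure_display) (Omega : measurableType d)
  (mu : probability Omega R) (n : nat) (hn : (1 <= n)%N)
  (Gamma gamma : R) (hGamma : 1 <= Gamma) (hgamma : 0 < gamma)
  (xi1 xi2 xi3 : n.-tuple Omega * n.-tuple Omega -> R)
  (mxi1 : measurable_fun [set: n.-tuple Omega * n.-tuple Omega] xi1)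
  (mxi2 : measurable_fun [set: n.-tuple Omega * n.-tuple Omega] xi2)
  (mxi3 : measurable_fun [set: n.-tuple Omega * n.-tuple Omega] xi3)
  (ixi1 : forall x : n.-tuple Omega, (power_probability mu n).-integrable
    [set: n.-tuple Omega] (fun y => (xi1 (x, y))%:E))
  (ixi2 : forall x : n.-tuple Omega, (power_probability mu n).-integrable
    [set: n.-tuple Omega] (fun y => (xi2 (x, y))%:E))
  (ixi3 : forall x : n.-tuple Omega, (power_probability mu n).-integrable
    [set: n.-tuple Omega] (fun y => (xi3 (x, y))%:E))
  (xi3_ge0 : forall z : n.-tuple Omega * n.-tuple Omega, 0 <= xi3 z)
  (htail : forall t : R, 0 <= t ->
    ((power_probability mu n \x power_probability mu n)%E
       [set z | (xi2 z + Num.sqrt (xi3 z * t) <= xi1 z)%R]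
     <= (Gamma * expR (- (gamma * t)))%:E)%E) :
  forall t : R, 0 <= t ->
    (power_probability mu n
       [set x | (partial_mean (power_probability mu n) xi2 x
                 + Num.sqrt (partial_mean (power_probability mu n) xi3 x * t)
                 <= partial_mean (power_probability mu n) xi1 x)%R]
     <= (Gamma * expR (1 - gamma * t))%:E)%E.
Proof.
have mxi12 : measurable_fun setT (xi1 \- xi2) by exact: measurable_funB.
have ixi12 x : (power_probability mu n).-integrable setT
    (fun y => ((xi1 \- xi2) (x, y))%:E).
  exact: (integrableB measurableT (ixi1 x) (ixi2 x)).
have shift (u v w : R) : (w <= u - v) = (v + w <= u) by rewrite lerBrDl.
move=> t t0; apply: le_trans (partial_mean_exp_tail hGamma hgamma mxi12 mxi3
  ixi12 ixi3 xi3_ge0 _ t0).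
  rewrite le_eqVlt; apply/orP; left; apply/eqP; congr (_ _).
  apply/funext => x/=; rewrite -shift /partial_mean RintegralB//.
  - exact: ixi1.
  - exact: ixi2.
move=> u u0; apply: le_trans (htail u u0).
rewrite le_eqVlt; apply/orP; left; apply/eqP; congr (_ _).
by apply/funext => z/=; rewrite shift.
Qed.
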